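(* Let $N\cong\mathbb{Z}^n$ be a lattice with dual lattice $M=\mathrm{Hom}(N,\mathbb{Z})$, let $l$ be a positive integer, and let $P\subset N_{\mathbb{Q}}$ be a lattice polytope with primitive vertices, such that $P$ contains the origin in its interior. Then $P$ is $l$-reflexive if and only if $lP^*$ is a lattice polytope (with respect to $M$) having only primitive vertices. In this case, $lP^*$ is also $l$-reflexive. This induces a duality for $l$-reflexive polytopes, $P\leftrightarrow lP^*$; that is, $l(lP^* )^*=P$.
   Context: $N_{\mathbb{Q}}=N\otimes_{\mathbb{Z}}\mathbb{Q}$, $M_{\mathbb{Q}}=M\otimes_{\mathbb{Z}}\mathbb{Q}$. A lattice polytope is a polytope whose vertices lie in the lattice. A nonzero lattice point $x$ is primitive if the segment from $\mathbf{0}$ to $x$ contains no lattice points other than its endpoints. For a full-dimensional lattice polytope $P$ with the origin in its interior and a facet $F$ of $P$, the primitive outer normal of $F$ is the unique primitive $u_F\in M$ such that $F=\{x\in P\mid\langle u_F,x\rangle=l_F\}$ for some positive integer $l_F$; $l_F$ is called the local index of $F$. $P$ is $l$-reflexive if it contains the origin in its interior, all its vertices are primitive, and $l_F=l$ for every facet $F$. The dual is $P^*=\{y\in M_{\mathbb{Q}}\mid\langle y,x\rangle\le 1\text{ for all }x\in P\}$. *)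

(* Defs.v *)
From mathcomp Require Import all_boot all_order all_algebra.
From mathcomp Require Import boolp classical_sets topology normedtype.

Set Implicit Arguments.
Unset Strict Implicit.
Unset Printing Implicit Defensive.

Import Order.TTheory GRing.Theory Num.Theory numFieldNormedType.Exports.
Local Open Scope classical_set_scope.
Local Open Scope ring_scope.

(* Fix a basis of N, and give M the dual basis: N_Q and M_Q both become
   'rV[rat]_n, the lattices N and M become the integral row vectors, and the
   duality pairing M_Q x N_Q -> Q becomes the dot product. Every notion below
   thus applies to subsets of N_Q and of M_Q alike. *)

Definition pairing n (u x : 'rV[rat]_n) : rat := \sum_(i < n) u 0 i * x 0 i.

Definition lattice n : set 'rV[rat]_n :=
  [set x | forall i, x 0 i \is a Num.int].

Definition primitive n (x : 'rV[rat]_n) : Prop :=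
  [/\ lattice x, x != 0 &
      forall t : rat, 0 <= t <= 1 -> lattice (t *: x) ->
        t *: x = 0 \/ t *: x = x].

Definition conv_hull n (s : seq 'rV[rat]_n) : set 'rV[rat]_n :=
  [set x | exists a : 'I_(size s) -> rat,
     [/\ forall i, 0 <= a i, \sum_i a i = 1 & x = \sum_i a i *: s`_i]].

Definition polytope n (P : set 'rV[rat]_n) : Prop :=
  exists s : seq 'rV[rat]_n, P = conv_hull s.

(* The choices u = 0 make P and set0 faces of P. *)
Definition face n (P F : set 'rV[rat]_n) : Prop :=
  exists (u : 'rV[rat]_n) (c : rat),
    (forall x, P x -> pairing u x <= c) /\
    F = [set x | P x /\ pairing u x = c].

(* [U] is the direction of the affine hull of [A]; the empty set has no
   dimension. *)
Definition affine_dim n (A : set 'rV[rat]_n) (d : nat) : Prop :=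
  A !=set0 /\
  exists U : {vspace 'rV[rat]_n},
    [/\ forall x y, A x -> A y -> x - y \in U,
        forall W : {vspace 'rV[rat]_n},
          (forall x y, A x -> A y -> x - y \in W) -> (U <= W)%VS
      & \dim U = d].

Definition vertex n (P : set 'rV[rat]_n) (v : 'rV[rat]_n) : Prop :=
  face P [set v].

Definition facet n (P F : set 'rV[rat]_n) : Prop :=
  face P F /\ exists d, affine_dim F d /\ affine_dim P d.+1.

Definition lattice_polytope n (P : set 'rV[rat]_n) : Prop :=
  polytope P /\ forall v, vertex P v -> lattice v.

Definition primitive_vertices n (P : set 'rV[rat]_n) : Prop :=
  forall v, vertex P v -> primitive v.

(* [rat^o] selects the topology of the order on rat, hence the product topology
   on row vectors. *)
Definition origin_in_interior n (P : set 'rV[rat]_n) : Prop :=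
  @interior 'rV[rat^o]_n P 0.

(* [u] is the primitive outer normal of the facet [F] of [P], and [l] its local
   index. When [P] has the origin in its interior, a facet [F] affinely spans a
   hyperplane missing the origin, so [u] and [l] are determined by [F]. *)
Definition outer_normal_index n (P F : set 'rV[rat]_n) (u : 'rV[rat]_n)
    (l : nat) : Prop :=
  [/\ primitive u, (0 < l)%N & F = [set x | P x /\ pairing u x = l%:R]].

Definition local_index n (P F : set 'rV[rat]_n) (l : nat) : Prop :=
  exists u, outer_normal_index P F u l.

Definition l_reflexive n (l : nat) (P : set 'rV[rat]_n) : Prop :=
  [/\ lattice_polytope P, origin_in_interior P, primitive_vertices P
    & forall F, facet P F -> local_index P F l].

Definition dual n (P : set 'rV[rat]_n) : set 'rV[rat]_n :=
  [set y | forall x, P x -> pairing y x <= 1].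

Definition dilate n (l : nat) (P : set 'rV[rat]_n) : set 'rV[rat]_n :=
  [set (l%:R : rat) *: x | x in P].

(* Main.v *)
(* With [polar l P = l P^*], the vertices of [polar l P] are exactly the points
   [w] for which [x \in P, <w, x> = l] is a facet of [P]. A facet of a polytope
   with the origin in its interior linearly spans the space, so [w] is the only
   vector taking the value [l] on it: it is the primitive outer normal of a
   facet of local index [l] if and only if it is primitive. Applied to
   [polar l P], whose polar is [P] again, the same argument yields the duality.
   That polars of polytopes are polytopes and that [polar l] is an involution
   both follow from the description of a finitely generated cone by finitely
   many inequalities, obtained by adding the generators one at a time. *)

From HB Require Import structures.
Require Import Defs.
From mathcomp Require Import all_boot all_order all_algebra.
From mathcomp Require Import ring lra zify.
From mathcomp Require Import boolp classical_sets topology normedtype.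

Set Implicit Arguments.
Unset Strict Implicit.
Unset Printing Implicit Defensive.

Import Order.TTheory GRing.Theory Num.Theory numFieldNormedType.Exports.
Local Open Scope classical_set_scope.
Local Open Scope ring_scope.

(** * The pairing and orthogonal hyperplanes *)

Lemma pairingC n (x y : 'rV[rat]_n) : pairing x y = pairing y x.
Proof. by apply: eq_bigr => i _; rewrite mulrC. Qed.

Lemma pairing_is_linear n (u : 'rV[rat]_n) : linear (pairing u : _ -> rat^o).
Proof.
move=> a x y; rewrite /pairing scaler_sumr -big_split /=.
by apply: eq_bigr => i _; rewrite !mxE mulrDr mulrCA.
Qed.

HB.instance Definition _ n (u : 'rV[rat]_n) :=
  GRing.isLinear.Build rat 'rV[rat]_n rat^o _ (pairing u : _ -> rat^o)
    (pairing_is_linear u).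

Lemma pairingDr n (u x y : 'rV[rat]_n) :
  pairing u (x + y) = pairing u x + pairing u y.
Proof. exact: raddfD. Qed.

Lemma pairingBr n (u x y : 'rV[rat]_n) :
  pairing u (x - y) = pairing u x - pairing u y.
Proof. exact: raddfB. Qed.

Lemma pairingZr n (u : 'rV[rat]_n) a x : pairing u (a *: x) = a * pairing u x.
Proof. by rewrite mulr_sumr; apply: eq_bigr => i _; rewrite mxE mulrCA. Qed.

Lemma pairing0r n (u : 'rV[rat]_n) : pairing u 0 = 0.
Proof. exact: (raddf0 (pairing u : _ -> rat^o)). Qed.

Lemma pairing_sumr n (u : 'rV[rat]_n) (I : Type) (r : seq I) (p : pred I) F :
  pairing u (\sum_(i <- r | p i) F i) = \sum_(i <- r | p i) pairing u (F i).
Proof. exact: (raddf_sum (pairing u : _ -> rat^o)). Qed.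

Lemma pairingDl n (u v x : 'rV[rat]_n) :
  pairing (u + v) x = pairing u x + pairing v x.
Proof. by rewrite ![pairing _ x]pairingC pairingDr. Qed.

Lemma pairingBl n (u v x : 'rV[rat]_n) :
  pairing (u - v) x = pairing u x - pairing v x.
Proof. by rewrite ![pairing _ x]pairingC pairingBr. Qed.

Lemma pairingZl n (u : 'rV[rat]_n) a x : pairing (a *: u) x = a * pairing u x.
Proof. by rewrite ![pairing _ x]pairingC pairingZr. Qed.

Lemma pairing0l n (x : 'rV[rat]_n) : pairing 0 x = 0.
Proof. by rewrite pairingC pairing0r. Qed.

Lemma pairing_delta n (u : 'rV[rat]_n) i : pairing u (delta_mx 0 i) = u 0 i.
Proof.
rewrite /pairing (bigD1 i) //= mxE !eqxx mulr1 big1 ?addr0 // => j ji.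
by rewrite mxE (negbTE ji) andbF mulr0.
Qed.

Lemma pairing_self_eq0 n (x : 'rV[rat]_n) : (pairing x x == 0) = (x == 0).
Proof.
apply/eqP/eqP => [xx0|->]; last exact: pairing0r.
apply/rowP => i; rewrite mxE; apply/eqP; rewrite -sqrf_eq0 expr2.
by apply/eqP; apply: (psumr_eq0P _ xx0) => // j _; rewrite -expr2 sqr_ge0.
Qed.

Definition perp n (z : 'rV[rat]_n) : {vspace 'rV[rat]_n} :=
  lker (linfun (pairing z : _ -> rat^o)).

Lemma mem_perp n (z x : 'rV[rat]_n) : (x \in perp z) = (pairing z x == 0).
Proof. by rewrite memv_ker lfunE. Qed.

Lemma perp_full n (z : 'rV[rat]_n) : (fullv <= perp z)%VS -> z = 0.
Proof.
move=> /subvP/(_ z (memvf z)); rewrite mem_perp pairing_self_eq0.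
exact: eqP.
Qed.

Lemma linear_functional_pairing n (f : {linear 'rV[rat]_n -> rat^o}) x :
  f x = pairing (\row_i f (delta_mx 0 i)) x.
Proof.
rewrite {1}(row_sum_delta x) linear_sum; apply: eq_bigr => i _.
by rewrite linearZ mxE mulrC.
Qed.

(* The functionals used are the coordinates of [x - projv W x]. *)
Lemma perp_trivial_full n (W : {vspace 'rV[rat]_n}) :
  (forall z, (W <= perp z)%VS -> z = 0) -> W = fullv.
Proof.
move=> Wperp; apply/eqP; rewrite eqEsubv subvf; apply/subvP => x _.
suff /eqP : x - projv W x = 0 by rewrite subr_eq0 => /eqP->; apply: memv_proj.
apply/rowP => j; rewrite [RHS]mxE.
pose f (y : 'rV[rat]_n) : rat^o := (y - projv W y) 0 j.
have f_lin : linear f.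
  by move=> a y y'; rewrite /f linearP !mxE /GRing.scale /=; ring.
pose fL := HB.pack_for {linear 'rV[rat]_n -> rat^o} f
  (GRing.isLinear.Build _ _ _ _ f f_lin).
rewrite -[LHS]/(fL x) linear_functional_pairing (Wperp (\row__ _)).
  exact: pairing0l.
apply/subvP => y yW; rewrite mem_perp -linear_functional_pairing.
by rewrite /= /f projv_id // subrr mxE.
Qed.

(** * Finitely generated cones are polyhedral *)

(** The recursion isolates the multiplier of one generator, which is the variable removed by one
    elimination step. *)
Fixpoint cone m (s : seq 'rV[rat]_m) (x : 'rV[rat]_m) : Prop :=
  if s is v :: s' then exists t, 0 <= t /\ cone s' (x - t *: v) else x = 0.

Lemma coneP m (s : seq 'rV[rat]_m) x :
  cone s x <-> exists a : nat -> rat,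
    (forall i, 0 <= a i) /\ x = \sum_(i < size s) a i *: s`_i.
Proof.
elim: s x => [|v s IHs] x /=.
  split=> [->|[a [_ ->]]]; last by rewrite big_ord0.
  by exists (fun=> 0); rewrite big_ord0.
split=> [[t [t0 /IHs[a [a0 xE]]]]|[a [a0 ->]]].
  exists (fun i => if i is j.+1 then a j else t); split; first by case.
  by rewrite big_ord_recl /= -xE addrC subrK.
exists (a 0%N); split=> //; apply/IHs; exists (a \o S); split=> [i|] /=.
  exact: a0.
by rewrite big_ord_recl /= addrC addKr.
Qed.

(* One step of Fourier-Motzkin elimination. *)
Lemma ray_system_solvable (I : eqType) (r : seq I) (p q : I -> rat) :
  (exists t, 0 <= t /\ {in r, forall j, p j <= t * q j}) <->
  {in r, forall j, q j <= 0 -> p j <= 0} /\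
  {in r &, forall j k, 0 < q j -> q k < 0 -> q j * p k - q k * p j <= 0}.
Proof.
split=> [[t [t0 tP]]|[]].
  split=> [j /tP pj qj|j k /tP pj /tP pk qj qk]; nra.
(* The witness is the least [t >= 0] meeting the constraints with [q j > 0]: the maximum of 0 and
   their lower bounds [p j / q j]. *)
move=> q_le0 pq; exists (\big[Num.max/0]_(j <- r | 0 < q j) (p j / q j)).
split=> [|k kr]; first exact: bigmax_ge_id.
case: (ltgtP (q k) 0) => [qk|qk|qk]; last first.
- by rewrite qk mulr0 q_le0 ?qk.
- by rewrite -ler_pdivrMr //; apply: le_bigmax_seq.
rewrite -ler_ndivlMr //; rewrite big_seq_cond; apply: bigmax_le.
  by rewrite mulr_le0 ?invr_le0 ?q_le0 // ltW.
move=> j /andP[jr qj]; rewrite ler_pdivrMr // mulrAC ler_ndivlMr //.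
by have := pq _ _ jr kr qj qk; lra.
Qed.

(** One half of the Minkowski-Weyl theorem: adding [v] asks for some [t >= 0] with [x - t *: v] in
    the smaller cone, and eliminating [t] from the inequalities of that cone leaves linear
    conditions on [x]. *)
Lemma cone_polyhedral m (s : seq 'rV[rat]_m) :
  exists L : seq 'rV[rat]_m,
    forall x, cone s x <-> {in L, forall b, pairing b x <= 0}.
Proof.
elim: s => [|v s [L LP]] /=.
  exists ([seq delta_mx 0 i | i <- enum 'I_m] ++
          [seq - delta_mx 0 i | i <- enum 'I_m]) => x.
  split=> [-> b _|xP]; first by rewrite pairing0r.
  apply/rowP => i; rewrite mxE; apply/eqP; rewrite eq_le.
  have xi : pairing (delta_mx 0 i) x <= 0.
    by apply: xP; rewrite mem_cat (map_f (delta_mx 0)) ?mem_enum.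
  have xNi : pairing (- delta_mx 0 i) x <= 0.
    apply: xP; rewrite mem_cat; apply/orP; right.
    by rewrite (map_f (fun i => - delta_mx 0 i)) ?mem_enum.
  move: xi xNi; rewrite -scaleN1r pairingZl pairingC pairing_delta mulN1r.
  by rewrite oppr_le0 => -> ->.
pose q b := pairing b v.
(* Inequalities nonpositive at [v] survive; each pair with opposite signs at [v] is replaced by the
   positive combination that vanishes at [v]. *)
exists ([seq b <- L | q b <= 0] ++
        [seq q b.1 *: b.2 - q b.2 *: b.1 |
           b <- [seq (b, c) | b <- L, c <- L] & (0 < q b.1) && (q b.2 < 0)]).
move=> x; have -> : (exists t, 0 <= t /\ cone s (x - t *: v)) <->
    exists t, 0 <= t /\ {in L, forall b, pairing b x <= t * q b}.
  by split=> -[t [t0 tP]]; exists t; split=> //; [move=> b /((LP _).1 tP)|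
    apply/LP => b /tP]; rewrite pairingBr pairingZr subr_le0.
rewrite ray_system_solvable; split=> [[Lneg Lpair] b|LP'].
  rewrite mem_cat => /orP[|/mapP[[c d] + ->]].
    by rewrite mem_filter => /andP[/[swap]]; apply: Lneg.
  rewrite mem_filter /= => /andP[/andP[qc qd] /allpairsP[[c' d'] /= [cL dL]]].
  by move=> [ec ed]; subst; rewrite pairingBl !pairingZl Lpair.
split=> [b bL qb|b c bL cL qb qc].
  by apply: LP'; rewrite mem_cat mem_filter qb bL.
rewrite -!pairingZl -pairingBl; apply: LP'; rewrite mem_cat; apply/orP; right.
apply/mapP; exists (b, c) => //; rewrite mem_filter /= qb qc /=.
exact: allpairs_f.
Qed.

(** * Convex hulls as intersections of half-spaces *)

Lemma conv_hullP n (s : seq 'rV[rat]_n) x :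
  conv_hull s x <-> exists a : nat -> rat,
    [/\ forall i, 0 <= a i, \sum_(i < size s) a i = 1
      & x = \sum_(i < size s) a i *: s`_i].
Proof.
split=> [[a [a0 a1 ->]]|[a [a0 a1 ->]]]; last by exists (fun i => a i).
exists (fun k => oapp a 0 (insub k)); split=> [k||].
- by case: insubP => //= i.
- by rewrite -a1; apply: eq_bigr => i _; rewrite valK.
- by apply: eq_bigr => i _; rewrite valK.
Qed.

(** Homogenization: with all generators at height 1, the height coordinate of a conic combination is
    the sum of its coefficients. *)
Lemma conv_hull_cone n (s : seq 'rV[rat]_n) (x : 'rV[rat]_n) :
  conv_hull s x <->
  cone [seq row_mx (1 : 'rV_1) y | y <- s] (row_mx (1 : 'rV_1) x).
Proof.
rewrite conv_hullP coneP size_map.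
have sumE (a : nat -> rat) :
    \sum_(i < size s) a i *: [seq row_mx (1 : 'rV[rat]_1) y | y <- s]`_i =
    row_mx (\sum_(i < size s) a i)%:M (\sum_(i < size s) a i *: s`_i).
  apply/rowP => k; rewrite summxE; case: (split_ordP k) => j ->.
    rewrite row_mxEl mxE ord1 mulr1n; apply: eq_bigr => i _.
    by rewrite mxE (nth_map 0) // row_mxEl mxE mulr1.
  rewrite row_mxEr summxE; apply: eq_bigr => i _.
  by rewrite mxE (nth_map 0) // row_mxEr mxE.
split=> [[a [a0 a1 ->]]|[a [a0]]]; first by exists a; rewrite sumE a1.
by rewrite sumE => /eq_row_mx[/rowP/(_ 0)]; rewrite !mxE => a1 ->; exists a.
Qed.

Lemma conv_hull_polyhedral n (s : seq 'rV[rat]_n) :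
  exists L : seq (rat * 'rV[rat]_n),
    forall x, conv_hull s x <-> {in L, forall cb, pairing cb.2 x <= cb.1}.
Proof.
have [L LP] := cone_polyhedral [seq row_mx (1 : 'rV_1) y | y <- s].
(* At height 1 the first coordinate of [b] contributes a constant, which moves to the right-hand
   side. *)
exists [seq (- lsubmx b 0 0, rsubmx b) | b : 'rV_(1 + n) <- L] => x.
have bE (b : 'rV_(1 + n)) : (pairing b (row_mx (1 : 'rV_1) x) <= 0) =
    (pairing (rsubmx b) x <= - lsubmx b 0 0).
  rewrite -[- _]sub0r lerBrDl /pairing big_split_ord big_ord1 /= row_mxEl.
  rewrite !mxE mulr1; congr (_ + _ <= _); apply: eq_bigr => i _.
  by rewrite row_mxEr mxE.
rewrite conv_hull_cone LP; split=> [LxP _ /mapP[b bL ->] /=|LxP b bL].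
  by rewrite -bE LxP.
by rewrite bE; apply: (LxP (_, _)); apply/mapP; exists b.
Qed.

Lemma conv_hull_mem n (s : seq 'rV[rat]_n) x : x \in s -> conv_hull s x.
Proof.
move=> xs; pose i0 := Ordinal (etrans (index_mem x s) xs).
exists (fun i => (i == i0)%:R); split=> [i||]; first by rewrite ler0n.
  by rewrite (bigD1 i0) //= eqxx big1 ?addr0 // => i /negbTE->.
rewrite (bigD1 i0) //= eqxx scale1r nth_index // big1 ?addr0 // => i /negbTE->.
by rewrite scale0r.
Qed.

Lemma pairing_conv_hull_le n (s : seq 'rV[rat]_n) z c :
  (forall x, conv_hull s x -> pairing z x <= c) <->
  {in s, forall x, pairing z x <= c}.
Proof.
split=> [zc x /conv_hull_mem/zc //|zc x [a [a0 a1 ->]]].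
rewrite pairing_sumr -[c]mul1r -a1 mulr_suml; apply: ler_sum => i _.
by rewrite pairingZr ler_wpM2l // zc // mem_nth.
Qed.

(** * Polars and the bipolar theorem *)

Definition polar n (l : rat) (P : set 'rV[rat]_n) : set 'rV[rat]_n :=
  [set z | forall x, P x -> pairing z x <= l].

Lemma dilate_dual n l (P : set 'rV[rat]_n) :
  (0 < l)%N -> dilate l (dual P) = polar l%:R P.
Proof.
move=> l0; have lr0 : 0 < l%:R :> rat by rewrite ltr0n.
apply/seteqP; split=> [_ [y yP <-] x Px|z zP].
  by rewrite pairingZl ler_piMr ?yP // ltW.
exists (l%:R^-1 *: z); last by rewrite scalerA mulfV ?scale1r ?gt_eqF.
by move=> x Px; rewrite pairingZl ler_pdivrMl // mulr1 zP.
Qed.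

(** Each inequality [pairing b x <= c] of the hull has [c >= 0], as 0 lies in the hull. If [c > 0],
    rescaling [b] by [l / c] gives a point of the polar, and the bipolar obeys the inequality. *)
Lemma polar_polar_conv_hull n l (s : seq 'rV[rat]_n) :
  0 < l -> conv_hull s 0 -> polar l (polar l (conv_hull s)) = conv_hull s.
Proof.
move=> l0 s0; have [L LP] := conv_hull_polyhedral s.
apply/seteqP; split=> [x xP|x sx z zP]; last by rewrite pairingC zP.
apply/LP => -[c b] cbL /=.
have bs y : conv_hull s y -> pairing b y <= c by move=> /LP/(_ _ cbL).
have := bs _ s0; rewrite pairing0r le_eqVlt => /predU1P[c0|c0]; last first.
  have /xP : polar l (conv_hull s) ((l / c) *: b).
    move=> y /bs; rewrite pairingZl mulrAC ler_pdivrMr //.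
    by rewrite ler_pM2l.
  by rewrite pairingZr mulrAC ler_pdivrMr // ler_pM2l // pairingC.
(* When [c = 0], all nonnegative multiples of [b] lie in the polar; the one chosen takes the value
   [2 * l] at [x], exceeding [l]. *)
subst c; rewrite leNgt; apply/negP => bx0.
have /xP : polar l (conv_hull s) ((2 * l / pairing b x) *: b).
  move=> y /bs by0; rewrite pairingZl (le_trans _ (ltW l0)) //.
  by rewrite mulr_ge0_le0 // divr_ge0 ?mulr_ge0 // ltW.
by rewrite pairingZr [pairing x b]pairingC divfK ?gt_eqF //; lra.
Qed.

(** * Interior origin and affine dimension *)

Lemma origin_in_interiorP n (P : set 'rV[rat]_n) :
  origin_in_interior P <->
  exists e : rat,
    0 < e /\ forall x : 'rV[rat]_n, (forall i, `|x 0 i| < e) -> P x.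
Proof.
rewrite /origin_in_interior /interior /=.
split=> [/nbhs_ballP[e e0 eP]|[e [e0 eP]]].
  exists e; split=> // x xe; apply: eP; split=> // i j.
  by rewrite !ord1 mxE /ball /= sub0r normrN xe.
apply/nbhs_ballP; exists e => // x [_ xe]; apply: eP => i.
by have := xe 0 i; rewrite mxE /ball /= sub0r normrN.
Qed.

Lemma dim_rV n : \dim {:'rV[rat]_n} = n.
Proof. by rewrite dimvf /dim /= mul1n. Qed.

Lemma origin_in_interior_mem n (P : set 'rV[rat]_n) :
  origin_in_interior P -> P 0.
Proof.
by move=> /origin_in_interiorP[e [e0 eP]]; apply: eP => i; rewrite mxE normr0.
Qed.

Lemma origin_in_interior_basis n (P : set 'rV[rat]_n) :
  origin_in_interior P ->
  exists e : rat, 0 < e /\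
    forall i, P (e *: delta_mx 0 i) /\ P (- e *: delta_mx 0 i).
Proof.
(* Halving keeps the points strictly inside the open box of radius [e]. *)
move=> /origin_in_interiorP[e [e0 eP]]; exists (e / 2).
split=> [|i]; first by rewrite divr_gt0.
have lt_e (a : rat) j : `|a| = e / 2 ->
    `|(a *: delta_mx 0 i : 'rV[rat]_n) 0 j| < e.
  rewrite mxE normrM => ->; rewrite mxE eqxx /=.
  by case: (j == i); rewrite ?normr1 ?normr0; lra.
by split; apply: eP => j; apply: lt_e; rewrite ?normrN gtr0_norm // divr_gt0.
Qed.

Lemma origin_in_interior_le0 n (P : set 'rV[rat]_n) b :
  origin_in_interior P -> (forall x, P x -> pairing b x <= 0) -> b = 0.
Proof.
move=> /origin_in_interior_basis[e [e0 eP]] b_le0; apply/rowP => i.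
rewrite mxE; have [/b_le0 + /b_le0] := eP i.
by rewrite !pairingZr pairing_delta; nra.
Qed.

Lemma affine_dim_interior n (P : set 'rV[rat]_n) :
  origin_in_interior P -> affine_dim P n.
Proof.
move=> Pint; have P0 := origin_in_interior_mem Pint.
have [e [e0 eP]] := origin_in_interior_basis Pint.
split; first by exists 0.
exists fullv; split=> [x y _ _|W PW|]; first exact: memvf; last exact: dim_rV.
apply/subvP => x _; rewrite (row_sum_delta x); apply: memv_suml => i _.
apply: memvZ; have /memvZ-/(_ e^-1) := PW _ _ (eP i).1 P0.
by rewrite subr0 scalerA mulVf ?gt_eqF // scale1r.
Qed.

Lemma affine_dim_unique n (A : set 'rV[rat]_n) d d' :
  affine_dim A d -> affine_dim A d' -> d = d'.
Proof.
move=> [_ [U [AU minU <-]]] [_ [V [AV minV <-]]].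
by apply/eqP; rewrite eqn_leq !dimvS ?minU ?minV.
Qed.

(** Among lists of points of [A], one whose span has maximal dimension works: adjoining another
    point of [A] cannot enlarge the span. *)
Lemma finite_spanning n (A : set 'rV[rat]_n) :
  exists s : seq 'rV[rat]_n,
    {in s, forall x, A x} /\ forall x, A x -> x \in <<s>>%VS.
Proof.
pose p k := `[< exists s : seq 'rV[rat]_n,
  {in s, forall x, A x} /\ \dim <<s>>%VS = k >].
have p0 : exists k, p k.
  by exists 0%N; apply/asboolP; exists [::]; rewrite span_nil dimv0.
have p_le k : p k -> (k <= n)%N.
  by move=> /asboolP[s [_ <-]]; rewrite -[leqRHS]dim_rV dimvS ?subvf.
case: (ex_maxnP p0 p_le) => _ /asboolP[s [sA <-]] max.
exists s; split=> // x Ax.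
have ss : (<<s>> <= <<x :: s>>)%VS by rewrite span_cons addvSr.
suff /eqP-> : <<s>>%VS == <<x :: s>>%VS by rewrite memv_span ?mem_head.
rewrite eqEdim ss max //; apply/asboolP; exists (x :: s); split=> //.
by move=> y; rewrite inE => /predU1P[->|/sA].
Qed.

Lemma affine_dim_exists n (A : set 'rV[rat]_n) :
  A !=set0 -> exists d, affine_dim A d.
Proof.
move=> A0.
pose B : set 'rV[rat]_n := [set z | exists x y, [/\ A x, A y & z = x - y]].
have [s [sB Bs]] := finite_spanning B.
exists (\dim <<s>>%VS); split=> //; exists <<s>>%VS.
split=> // [x y Ax Ay|W AW].
  by apply: Bs; exists x, y.
by apply/span_subvP => _ /sB[x [y [Ax Ay ->]]]; apply: AW.
Qed.

(** * Polars as polytopes around the origin *)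

(** Supplies a step size small enough for finitely many strict inequalities to survive a
    perturbation. *)
Lemma exists_scaling_le (I : eqType) (r : seq I) (f g : I -> rat) :
  {in r, forall i, 0 <= f i} -> {in r, forall i, 0 < g i} ->
  exists e, 0 < e /\ {in r, forall i, e * f i <= g i}.
Proof.
elim: r => [|i r IHr] f0 g0; first by exists 1.
have sub j : j \in r -> j \in i :: r by move=> jr; rewrite inE jr orbT.
have [|j /sub/g0 //|e [e0 ef]] := IHr; first by move=> j /sub/f0.
have fi0 := f0 i (mem_head _ _); have gi0 := g0 i (mem_head _ _).
(* Adding 1 keeps the denominator positive even where [f i] vanishes. *)
have fi1 : 0 < f i + 1 by lra.
have e'0 : 0 < g i / (f i + 1) by rewrite divr_gt0.
exists (Num.min e (g i / (f i + 1))); split; first by rewrite lt_min e0.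
move=> j; rewrite inE => /predU1P[->|jr].
  apply: (@le_trans _ _ (g i / (f i + 1) * f i)).
    by rewrite ler_wpM2r // ge_min lexx orbT.
  by rewrite mulrAC ler_pdivrMr // ler_pM2l //; lra.
by apply: le_trans (ef _ jr); rewrite ler_wpM2r ?f0 ?sub // ge_min lexx.
Qed.

(** Only the finitely many generators matter, and the pairing with each is at most its sum of
    absolute coordinates times the largest absolute coordinate of [z]. *)
Lemma polar_origin_in_interior n l (s : seq 'rV[rat]_n) :
  0 < l -> origin_in_interior (polar l (conv_hull s)).
Proof.
move=> l0; apply/origin_in_interiorP.
have [||e [e0 es]] := @exists_scaling_le _ s
  (fun x : 'rV[rat]_n => \sum_i `|x 0 i|) (fun=> l) => //.
  by move=> x _; apply: sumr_ge0 => i _; apply: normr_ge0.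
exists e; split=> // z ze; apply/pairing_conv_hull_le => x xs.
apply: le_trans (es _ xs); rewrite mulr_sumr; apply: ler_sum => i _.
by rewrite (le_trans (ler_norm _)) // normrM ler_wpM2r // ltW.
Qed.

(** The inequalities of [P], rescaled to right-hand side [l], show that [P] is the polar of a
    polytope; the bipolar theorem then identifies the polar of [P] with that polytope. *)
Lemma polytope_polar n l (P : set 'rV[rat]_n) :
  0 < l -> polytope P -> origin_in_interior P -> polytope (polar l P).
Proof.
move=> l0 [s PE] Pint; have [L LP] := conv_hull_polyhedral s.
(* A constraint [<b, x> <= 0] forces [b = 0], so the junk value [l / 0 = 0]
   harmlessly turns it into the generator [0]. *)
pose t := 0 :: [seq (l / cb.1) *: cb.2 | cb <- L].
suff -> : P = polar l (conv_hull t).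
  (* The generator 0 was put into [t] because the bipolar theorem needs the hull to contain the
     origin. *)
  exists t; rewrite polar_polar_conv_hull //; apply: conv_hull_mem.
  exact: mem_head.
have P0 := origin_in_interior_mem Pint.
have Lb c b : (c, b) \in L -> forall x, P x -> pairing b x <= c.
  by move=> cbL x; rewrite PE => /LP/(_ _ cbL).
apply/seteqP; split=> [x Px|x /pairing_conv_hull_le xt].
  apply/pairing_conv_hull_le => y; rewrite inE => /predU1P[->|].
    by rewrite pairing0r ltW.
  move=> /mapP[[c b] cbL ->] /=; have := Lb _ _ cbL _ P0.
  rewrite pairing0r le_eqVlt => /predU1P[<-|c0].
    by rewrite invr0 mulr0 scale0r pairing0r ltW.
  by rewrite pairingZr pairingC mulrAC ler_pdivrMr // ler_pM2l // (Lb _ b).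
rewrite PE; apply/LP => -[c b] cbL /=; have := Lb _ _ cbL _ P0.
rewrite pairing0r le_eqVlt => /predU1P[c0|c0].
  subst c; rewrite (origin_in_interior_le0 Pint (Lb _ _ cbL)).
  by rewrite pairing0l.
have : pairing x ((l / c) *: b) <= l.
  by apply: xt; rewrite inE; apply/orP; right; apply/mapP; exists (c, b).
by rewrite pairingZr mulrAC ler_pdivrMr // ler_pM2l // pairingC.
Qed.

(** * Facets of a polytope and vertices of its polar *)

Lemma facet_polar_vertex n l (P F : set 'rV[rat]_n) :
  0 < l -> origin_in_interior P -> facet P F ->
  exists w, vertex (polar l P) w /\ F = [set x | P x /\ pairing w x = l].
Proof.
move=> l0 Pint [[u [c [uc FE]]] [d [Fdim Pdim]]].
have P0 := origin_in_interior_mem Pint.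
have dn := affine_dim_unique Pdim (affine_dim_interior Pint).
have c0 : 0 < c.
  (* If [c = 0] then [u = 0] and [F = P], so the dimensions of [F] and [P] could not differ by
     one. *)
  have := uc _ P0; rewrite pairing0r le_eqVlt => /predU1P[c0|//]; subst c.
  have u0 := origin_in_interior_le0 Pint uc; suff FP : F = P.
    by move: Fdim; rewrite FP => /affine_dim_unique/(_ Pdim); lia.
  by rewrite FE u0; apply/seteqP; split=> [x [] //|x Px]; rewrite /= pairing0l.
pose w := (l / c) *: u.
have w_eq x : (pairing w x == l) = (pairing u x == c).
  rewrite pairingZl -(inj_eq (mulfI (lt0r_neq0 c0))) mulrA mulrCA [c * l]mulrC.
  by rewrite (divff (lt0r_neq0 c0)) mulr1 (inj_eq (mulfI (lt0r_neq0 l0))).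
have {}FE : F = [set x | P x /\ pairing w x = l].
  by rewrite FE; apply/seteqP; split=> x [Px /eqP xc]; split=> //; apply/eqP;
    rewrite ?w_eq // -w_eq.
have wP : polar l P w.
  by move=> x /uc; rewrite pairingZl mulrAC ler_pdivrMr // ler_pM2l.
exists w; split=> //; have [s [sF Fs]] := finite_spanning F.
(* The sum of a spanning list of points of [F] exposes [w]: each summand is at most [l] on the
   polar, so equality of the sums forces equality in every term. *)
exists (\sum_(x <- s) x), (\sum_(x <- s) l); split=> [z zP|].
  rewrite pairingC pairing_sumr big_seq [leRHS]big_seq; apply: ler_sum => x.
  by move=> /sF; rewrite FE => -[/zP].
apply/seteqP; split=> [_ ->|z [zP zs]].
  split=> //; rewrite pairingC pairing_sumr; apply: eq_big_seq => x /sF.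
  by rewrite FE => -[].
have zF : (<<s>> <= perp (z - w))%VS.
  apply/span_subvP => x xs; have := sF _ xs; rewrite FE => -[Px wx].
  rewrite mem_perp pairingBl wx subr_eq0 eq_le zP //= -subr_le0.
  have /eqP : \sum_(y <- s | y \in s) (l - pairing z y) = 0.
    by rewrite -big_seq sumrB -zs pairingC pairing_sumr subrr.
  rewrite psumr_eq0 => [/allP/(_ _ xs)|y /sF]; last first.
    by rewrite FE subr_ge0 => -[/zP].
  by rewrite xs => /eqP->.
have [[f Ff] [U [FU minU dimU]]] := Fdim.
have Uz : (U <= perp (z - w))%VS.
  by apply: minU => x y Fx Fy; apply: (subvP zF); rewrite memvB ?Fs.
have Uw : (U <= perp w)%VS.
  apply: minU => x y; rewrite FE => -[_ wx] [_ wy].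
  by rewrite mem_perp pairingBr wx wy subrr.
have fU : f \notin U.
  apply/negP => /(subvP Uw); move: Ff; rewrite FE mem_perp => -[_ ->].
  by rewrite gt_eqF.
apply/eqP; rewrite /= -subr_eq0; apply/eqP/perp_full.
suff /eqP-> : perp (z - w) == fullv by [].
(* Otherwise [perp (z - w)] has dimension at most [d] and coincides with [U]; but it contains [f],
   which [U] does not. *)
rewrite eqEdim subvf dim_rV -[leqLHS]dn ltnNge; apply: contra fU => dU.
suff /eqP-> : U == perp (z - w) by apply: (subvP zF); apply: Fs.
by rewrite eqEdim Uz dimU.
Qed.

(** The generators of [P] on which [v] takes the value [l] span the space. This gives both the
    dimension of the face and the uniqueness of [v]. *)
Lemma polar_vertex_facet n l (P : set 'rV[rat]_n) v :
  (0 < n)%N -> 0 < l -> polytope P -> origin_in_interior P ->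
  vertex (polar l P) v ->
  facet P [set x | P x /\ pairing v x = l] /\
  forall u, (forall x, P x -> pairing v x = l -> pairing u x = l) -> u = v.
Proof.
move=> n0 l0 [s PE] Pint [x0 [c [x0c vE]]].
have [vP x0v] : polar l P v /\ pairing x0 v = c.
  by have : [set v] v by []; rewrite vE.
have sP x : x \in s -> P x by rewrite PE; apply: conv_hull_mem.
have svP x : x \in s -> pairing v x <= l by move=> /sP/vP.
pose T := [seq x <- s | pairing v x == l].
have Tperp z : (<<T>> <= perp z)%VS -> z = 0.
  move=> Tz.
  have [||e [e0 es]] := @exists_scaling_le _ [seq x <- s | x \notin T]
    (fun x => `|pairing z x|) (fun x => l - pairing v x).
  - by move=> x _; apply: normr_ge0.
  - move=> x; rewrite mem_filter => /andP[+ xs]; rewrite mem_filter xs andbT.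
    by move=> vx; rewrite subr_gt0 lt_neqAle vx svP.
  (* A direction [z] orthogonal to all tight generators can be followed both ways from [v] inside
     the polar: tight inequalities do not change, and [e] fits within the slack of the others. *)
  have move_v a : `|a| = e -> polar l P (v + a *: z).
    rewrite PE => ae; apply/pairing_conv_hull_le => x xs.
    rewrite pairingDl pairingZl; have [xT|xT] := boolP (x \in T).
      have /(subvP Tz) := memv_span xT; rewrite mem_perp => /eqP->.
      by rewrite mulr0 addr0 svP.
    rewrite -lerBrDl (le_trans (ler_norm _)) // normrM ae es //.
    by rewrite mem_filter xT.
  have /move_v vez : `|e| = e by rewrite gtr0_norm.
  have /move_v/x0c : `|- e| = e by rewrite normrN gtr0_norm.
  (* Since [x0] is maximal at [v] and both [v + e *: z] and [v - e *: z] are in the polar, [x0] is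
     orthogonal to [z], so [v + e *: z] lies in the face [[set v]]. *)
  have := x0c _ vez; rewrite !pairingDr !pairingZr x0v => le1 le2.
  have : [set v] (v + e *: z).
    by rewrite vE; split=> //; rewrite pairingDr pairingZr x0v; lra.
  move=> /eqP; rewrite -subr_eq0 addrC addKr scaler_eq0 gt_eqF //=.
  exact: eqP.
have Tfull := perp_trivial_full Tperp.
split; last first.
  move=> u uv; apply/eqP; rewrite -subr_eq0; apply/eqP/Tperp/span_subvP => x.
  rewrite mem_filter => /andP[/eqP vx /sP Px].
  by rewrite mem_perp pairingBl vx uv // subrr.
have [t tT] : exists t, t \in T.
  case E : T => [|t T']; last by exists t; rewrite mem_head.
  by have := dim_rV n; rewrite -Tfull E span_nil dimv0; move: n0 => /[swap] <-.
have TF x : x \in T -> P x /\ pairing v x = l.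
  by rewrite mem_filter => /andP[/eqP vx /sP Px].
split; first by exists v, l.
have [d Fdim] : exists d, affine_dim [set x | P x /\ pairing v x = l] d.
  by apply: affine_dim_exists; exists t; apply: TF.
exists d; split=> //; suff -> : d.+1 = n by apply: affine_dim_interior.
(* [U] is proper, as it lies in [perp v] and [t] does not; together with the single vector [t] it
   spans everything. *)
have [_ [U [FU minU <-]]] := Fdim; apply/eqP; rewrite eqn_leq.
apply/andP; split.
  rewrite -[leqRHS]dim_rV ltnNge.
  have Uv : (U <= perp v)%VS.
    by apply: minU => x y [_ vx] [_ vy]; rewrite mem_perp pairingBr vx vy subrr.
  apply/negP => nU; have /eqP U1 : U == fullv by rewrite eqEdim subvf.
  have := subvP Uv t; rewrite U1 memvf mem_perp (TF _ tT).2 gt_eqF //.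
  by move=> /(_ isT).
have : (fullv <= U + <[t]>)%VS.
  rewrite -Tfull; apply/span_subvP => x xT; rewrite -[x](subrK t).
  by rewrite memv_add ?memv_line // FU //; apply: TF.
move=> /dimvS; rewrite dim_rV => /leq_trans; apply.
rewrite (leq_trans (dimv_add_leqif _ _)) // dim_vline.
by case: (t != 0); rewrite ?addn1 ?addn0.
Qed.

(** * Reflexivity and the duality *)

Lemma l_reflexive_of_polar n l (P : set 'rV[rat]_n) :
  (0 < l)%N -> lattice_polytope P -> primitive_vertices P ->
  origin_in_interior P -> primitive_vertices (polar l%:R P) ->
  l_reflexive l P.
Proof.
move=> l0 latP primP Pint prim_polar; split=> // F FP.
have [|w [/prim_polar w_prim FE]] := facet_polar_vertex _ Pint FP (l := l%:R).
  by rewrite ltr0n.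
by exists w.
Qed.

(** In dimension 0 the only point is 0; it would be a vertex, yet primitive vectors are nonzero. *)
Lemma primitive_vertices_dim_gt0 n (P : set 'rV[rat]_n) :
  P !=set0 -> primitive_vertices P -> (0 < n)%N.
Proof.
case: n P => // P [x Px] primP; have [|_ + _] := primP x.
  exists 0, 0; split=> [y _|]; first by rewrite pairing0l.
  by apply/seteqP; split=> [_ ->|y _]; rewrite /= ?pairing0l //;
    apply/rowP => -[].
by move=> /eqP[]; apply/rowP => -[].
Qed.

Theorem proposition1p2 (n l : nat) (P : set 'rV[rat]_n)
  (hl : (0 < l)%N)
  (hP : lattice_polytope P)
  (hprim : primitive_vertices P)
  (h0 : origin_in_interior P) :
  (l_reflexive l P <->
     (lattice_polytope (dilate l (dual P)) /\
      primitive_vertices (dilate l (dual P)))) /\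
  (l_reflexive l P ->
     l_reflexive l (dilate l (dual P)) /\
     dilate l (dual (dilate l (dual P))) = P).
Proof.
have l0 : 0 < l%:R :> rat by rewrite ltr0n.
have P0 := origin_in_interior_mem h0.
have n0 : (0 < n)%N by apply: primitive_vertices_dim_gt0 hprim; exists 0.
have [s PE] := hP.1.
have bipolar : polar l%:R (polar l%:R P) = P.
  by rewrite PE polar_polar_conv_hull // -PE.
rewrite !dilate_dual //.
have reflP : l_reflexive l P ->
    lattice_polytope (polar l%:R P) /\ primitive_vertices (polar l%:R P).
  move=> [_ _ _ indexP].
  have prim_polar : primitive_vertices (polar l%:R P).
    move=> v /(polar_vertex_facet n0 l0 hP.1 h0)[/indexP[u [u_prim _ FE]] uniq].
    (* The primitive normal [u] of the facet cut out by [v] also takes the value [l] there, so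
       [u = v]. *)
    rewrite -(uniq u) // => x Px vx.
    by have : [set x | P x /\ pairing v x = l%:R] x by []; rewrite FE => -[].
  split=> //; split; first exact: polytope_polar l0 hP.1 h0.
  by move=> v /prim_polar[].
split; first by split=> [/reflP //|[_ prim_polar]]; apply: l_reflexive_of_polar.
move=> /reflP[lat_polar prim_polar]; split=> //.
apply: l_reflexive_of_polar => //; last by rewrite bipolar.
by rewrite PE; apply: polar_origin_in_interior.
Qed.
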